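(* Let $f:R\to R'$ be a ring isomorphism. Then for every anti-ideal ${}^{a}\mathcal{I}$ on $R$, the image $f({}^{a}\mathcal{I})=\{f(x): x\in{}^{a}\mathcal{I}\}$ is an anti-ideal on $R'$.
   Context: Let $(R,+,\cdot)$ be a ring. A subset $A\subseteq R$ is called an anti-ideal on $R$ if (i) for all $a,b\in A$, $a-b\notin A$; and (ii) for all $a,b\in A$ with $a\neq b$, $(a+b)+a\cdot b\notin A$. *)

(* Defs.v *)
From HB Require Import structures.
From mathcomp Require Import all_boot all_order all_algebra.
From mathcomp Require Import classical_sets.

Set Implicit Arguments.
Unset Strict Implicit.
Unset Printing Implicit Defensive.

Import GRing.Theory.

Local Open Scope ring_scope.
Local Open Scope classical_set_scope.

(* Associative rings, not necessarily commutative and not necessarily with a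
   unit: MathComp's pzRingType always has a 1.  The multiplication comes from
   semigroupType, so it is written (x * y)%g. *)
HB.mixin Record Zmodule_Semigroup_isRng R of GRing.Zmodule R & Semigroup R := {
  rng_mulDl : left_distributive ( *%g : R -> R -> R) +%R;
  rng_mulDr : right_distributive ( *%g : R -> R -> R) +%R
}.

#[short(type="rngType")]
HB.structure Definition Rng :=
  { R of Zmodule_Semigroup_isRng R & GRing.Zmodule R & Semigroup R }.

(* Every unital ring is a ring in this sense.  The alias keeps the instance
   from interfering with the types that already carry a group structure. *)
Definition rng_of_ring (R : pzRingType) : Type := R.

HB.instance Definition _ (R : pzRingType) := GRing.Zmodule.on (rng_of_ring R).

HB.instance Definition _ (R : pzRingType) :=
  isSemigroup.Build (rng_of_ring R) (@mulrA R).

HB.instance Definition _ (R : pzRingType) :=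
  Zmodule_Semigroup_isRng.Build (rng_of_ring R) (@mulrDl R) (@mulrDr R).

(* No condition on units: for unital rings f 1 = 1 follows from bijectivity. *)
Definition rng_isomorphism (R R' : rngType) (f : R -> R') : Prop :=
  [/\ {morph f : x y / x + y}, {morph f : x y / (x * y)%g} & bijective f].

Definition anti_ideal (R : rngType) (A : set R) : Prop :=
  (forall a b : R, A a -> A b -> ~ A (a - b)) /\
  (forall a b : R, A a -> A b -> a <> b -> ~ A ((a + b) + (a * b)%g)).

(* Main.v *)
Require Import Defs.
From mathcomp Require Import all_boot all_order all_algebra.
From mathcomp Require Import classical_sets.

Local Open Scope classical_set_scope.

(** Both conditions say that a certain element is outside the set, so injectivity
    of [f] carries the weight: a forbidden relation among elements of the image
    is the image of one relation in [R], which [f] then reflects. *)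
Theorem theorem3p7 (R R' : rngType) (f : R -> R') (hf : rng_isomorphism f)
    (I : set R) (hI : anti_ideal I) : anti_ideal (f @` I).
Proof.
case: hf => fD fM /bij_inj f_inj; case: hI => subI circI.
split=> _ _ [a Ia <-] [b Ib <-].
- (* Written as f c + f b = f a, the relation uses additivity of f alone,
     without f (- b) = - f b. *)
  case=> c Ic /esym/eqP; rewrite GRing.subr_eq -fD => /eqP/f_inj a_eq.
  by apply: (subI a b Ia Ib); rewrite a_eq GRing.addrK.
- move=> fab [c Ic]; rewrite -fM -!fD => /f_inj c_eq.
  by apply: (circI a b Ia Ib) => [ab|]; [apply: fab; rewrite ab | rewrite -c_eq].
Qed.
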